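(* Let $K=\mathbb{R}$ or $\mathbb{C}$, let $\lambda\in K$ be nonzero, let $J\subset K$ be a nonempty connected open set, and let $k_2,k_4,k_6,k_8:J\to K$ be smooth (holomorphic if $K=\mathbb{C}$) functions with $$k_2'=\frac{\lambda}{2}k_4,\qquad k_4'=\frac{3\lambda}{4}k_6,\qquad k_6'=\lambda k_8,$$ where $'$ is the derivative with respect to the coordinate of $J$. Put $\phi=-\lambda k_2/4$, and let $U\subset K^3$ be a domain with coordinates $(t^1,t^2,t^3)$ whose projection to the $t^3$-axis is $J$. Then the associativity condition $$4k_8=k_4^2-k_6k_2$$ in the universal symmetric $2$-algebraic two-valued group (holding identically on $J$) is equivalent to the quantum Yang--Baxter equation $$R_{12}R_{13}R_{23}=R_{23}R_{13}R_{12}$$ holding at every point of $U$ for the operator $R=QT$ attached to the Dubrovin--Frobenius structure on the three-dimensional domain $U$ with potential $$F(t)=\frac12(t^1)^2t^3+\frac12t^1(t^2)^2-\frac{(t^2)^4}{96}\,\phi(t^3)$$ and Casimir element $Q=e_1\otimes e_3+e_2\otimes e_2+e_3\otimes e_1$, where $e_k=\partial/\partial t^k$.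
   Context: Two-valued side: with $\sigma_1=x+y+z$, $\sigma_2=xy+yz+xz$, $\sigma_3=xyz$, the polynomial $P_2(z;x,y)=\sigma_1^2-4\sigma_2+k_2\sigma_3+k_8\sigma_3^2+k_4\sigma_1\sigma_3+k_6\sigma_2\sigma_3$ defines the two-valued multiplication $x\ast y=[z\mid P_2(z;x,y)=0]$ on $\mathbb{C}$ (multiset of roots in $z$). It is known to be associative if and only if $4k_8=k_4^2-k_6k_2$, which is called the associativity condition of the universal symmetric $2$-algebraic two-valued group. In the paper the $k_j$ are functions of $\tau$ in the upper half-plane with $'=\frac{1}{2\pi i}\frac{d}{d\tau}$, which is the derivative with respect to $t^3=2\pi i\tau$. Dubrovin--Frobenius side: at each point of $U$, the tangent space $A$ with basis $e_1,e_2,e_3$ carries the metric $\eta(e_\alpha,e_\beta)=\delta_{\alpha+\beta,4}$ (so $(e_1,e_2,e_3)$ and $(e_3,e_2,e_1)$ are dual bases) and the commutative, a priori not necessarily associative, product $$e_\alpha\cdot e_\beta=\sum_{\gamma=1}^3\frac{\partial^3F}{\partial t^\alpha\partial t^\beta\partial t^{4-\gamma}}e_\gamma$$ with unit $e_1$. Writing $f(t^2,t^3)=-\frac{(t^2)^4}{96}\phi(t^3)$ and, with $x=t^2$, $y=t^3$, $a=f_{xxy}$, $b=f_{xxx}$, $c=f_{xyy}$, $d=f_{yyy}$, the product is $e_2^2=ae_1+be_2+e_3$, $e_2e_3=ce_1+ae_2$, $e_3^2=de_1+ce_2$. $T(u\otimes v)=v\otimes u$, and $R=QT\in\mathrm{End}(A\otimes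 A)$ is $T$ followed by multiplication by $Q$, i.e. $R(u\otimes v)=(e_1v)\otimes(e_3u)+(e_2v)\otimes(e_2u)+(e_3v)\otimes(e_1u)$. $R_{ij}$ denotes $R$ acting on the $i$-th and $j$-th factors of $A\otimes A\otimes A$ and as the identity on the other factor. *)

(* Defs.v *)
From HB Require Import structures.
From mathcomp Require Import all_boot all_order all_algebra.
From mathcomp Require Import complex.
From mathcomp Require Import all_classical all_reals all_analysis.

Set Implicit Arguments.
Unset Strict Implicit.
Unset Printing Implicit Defensive.

Import Order.TTheory GRing.Theory Num.Theory.
Import numFieldNormedType.Exports.

Local Open Scope ring_scope.
Local Open Scope classical_set_scope.

(* The choice "K = R or C"; both branches carry the topology and the          *)
(* derivative that MathComp-Analysis attaches to any numFieldType, so that    *)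
(* for ComplexScalars derivable and f^`() are complex differentiation.        *)
Variant scalars := RealScalars | ComplexScalars.

Definition scalar_field (R : realType) (s : scalars) : numFieldType :=
  match s with
  | RealScalars => R
  | ComplexScalars => R[i]%C
  end.

Definition domain (T : topologicalType) (D : set T) : Prop :=
  [/\ D !=set0, connected D & open D].

(* Functions on J are represented by total functions, whose values outside J  *)
(* are irrelevant since J is open.                                            *)
Definition smooth_on (R : realType) (s : scalars)
    (J : set (scalar_field R s))
    (f : scalar_field R s -> scalar_field R s) : Prop :=
  match s with
  | RealScalars => forall (n : nat) x, J x -> derivable (f^`(n)) x 1
  | ComplexScalars => forall x, J x -> derivable f x 1
  end.

Section DubrovinFrobenius.
Variable K : numFieldType.

(* Zero-based indices: the ordinal i stands for the index i + 1 of the basis  *)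
(* e_1, e_2, e_3 and of t^1, t^2, t^3, so rev_ord is gamma |-> 4 - gamma.     *)
Definition ix1 : 'I_3 := @Ordinal 3 0 isT.
Definition ix2 : 'I_3 := @Ordinal 3 1 isT.
Definition ix3 : 'I_3 := @Ordinal 3 2 isT.

Definition basis (i : 'I_3) : 'rV[K]_3 := delta_mx 0 i.

Definition pderiv (i : 'I_3) (G : 'rV[K]_3 -> K) : 'rV[K]_3 -> K :=
  fun t => 'D_(basis i) G t.

Definition potential (phi : K -> K) (t : 'rV[K]_3) : K :=
  2^-1 * t 0 ix1 ^+ 2 * t 0 ix3 + 2^-1 * t 0 ix1 * t 0 ix2 ^+ 2
  - t 0 ix2 ^+ 4 / 96 * phi (t 0 ix3).

Section AtPoint.
Variables (F : 'rV[K]_3 -> K) (t : 'rV[K]_3).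

Definition struct_const (a b c : 'I_3) : K :=
  pderiv a (pderiv b (pderiv (rev_ord c) F)) t.

Definition tangent_mul (u v : 'rV[K]_3) : 'rV[K]_3 :=
  \sum_a \sum_b \sum_c (u 0 a * v 0 b * struct_const a b c) *: basis c.

(* A (x) A and A (x) A (x) A are given by coordinates in the bases            *)
(* e_i (x) e_j and e_i (x) e_j (x) e_k.                                       *)
Definition tensor2 := {ffun 'I_3 * 'I_3 -> K}.
Definition tensor3 := {ffun 'I_3 * 'I_3 * 'I_3 -> K}.

Definition tens (u v : 'rV[K]_3) : tensor2 :=
  [ffun ij : 'I_3 * 'I_3 => u 0 ij.1 * v 0 ij.2].

Definition tensor2_mul (w w' : tensor2) : tensor2 :=
  [ffun ij => \sum_(p : 'I_3 * 'I_3) \sum_(q : 'I_3 * 'I_3)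
     w p * w' q * tens (tangent_mul (basis p.1) (basis q.1))
                       (tangent_mul (basis p.2) (basis q.2)) ij].

Definition casimir : tensor2 :=
  [ffun ij => tens (basis ix1) (basis ix3) ij
            + tens (basis ix2) (basis ix2) ij
            + tens (basis ix3) (basis ix1) ij].

Definition flip (w : tensor2) : tensor2 :=
  [ffun ij : 'I_3 * 'I_3 => w (ij.2, ij.1)].

Definition R_operator (w : tensor2) : tensor2 := tensor2_mul casimir (flip w).

End AtPoint.

Definition act12 (S : tensor2 -> tensor2) (w : tensor3) : tensor3 :=
  [ffun ijk : 'I_3 * 'I_3 * 'I_3 =>
     S [ffun p : 'I_3 * 'I_3 => w (p.1, p.2, ijk.2)] (ijk.1.1, ijk.1.2)].

Definition act13 (S : tensor2 -> tensor2) (w : tensor3) : tensor3 :=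
  [ffun ijk : 'I_3 * 'I_3 * 'I_3 =>
     S [ffun p : 'I_3 * 'I_3 => w (p.1, ijk.1.2, p.2)] (ijk.1.1, ijk.2)].

Definition act23 (S : tensor2 -> tensor2) (w : tensor3) : tensor3 :=
  [ffun ijk : 'I_3 * 'I_3 * 'I_3 =>
     S [ffun p : 'I_3 * 'I_3 => w (ijk.1.1, p.1, p.2)] (ijk.1.2, ijk.2)].

Definition quantum_yang_baxter (S : tensor2 -> tensor2) : Prop :=
  act12 S \o act13 S \o act23 S =1 act23 S \o act13 S \o act12 S.

Lemma tangent_mulE F t u v c :
  tangent_mul F t u v 0 c = \sum_a \sum_b u 0 a * v 0 b * struct_const F t a b c.
Proof.
rewrite summxE; apply: eq_bigr => a _; rewrite summxE; apply: eq_bigr => b _.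
rewrite summxE (bigD1 c)//= big1 => [|d dc]; rewrite !mxE ?eqxx ?mulr1 ?addr0//.
by rewrite [c == d]eq_sym (negbTE dc) mulr0.
Qed.

Lemma tangent_mul_basisl F t i v c :
  tangent_mul F t (basis i) v 0 c = \sum_b v 0 b * struct_const F t i b c.
Proof.
rewrite tangent_mulE (bigD1 i)//= [X in _ + X]big1 ?addr0.
  by apply: eq_bigr => b _; rewrite mxE !eqxx mul1r.
by move=> a ai; rewrite big1// => b _; rewrite mxE (negbTE ai) !mul0r.
Qed.

Lemma tangent_mul_basis F t i j c :
  tangent_mul F t (basis i) (basis j) 0 c = struct_const F t i j c.
Proof.
rewrite tangent_mul_basisl (bigD1 j)//= [X in _ + X]big1 ?addr0.
  by rewrite mxE !eqxx mul1r.
by move=> b bj; rewrite mxE (negbTE bj) mul0r.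
Qed.

Lemma R_operator_tens F t u v :
  R_operator F t (tens u v) =
  tens (tangent_mul F t (basis ix1) v) (tangent_mul F t (basis ix3) u)
  + tens (tangent_mul F t (basis ix2) v) (tangent_mul F t (basis ix2) u)
  + tens (tangent_mul F t (basis ix3) v) (tangent_mul F t (basis ix1) u).
Proof.
have key (i j k l : 'I_3) :
  \sum_(p : 'I_3 * 'I_3) \sum_(q : 'I_3 * 'I_3)
     tens (basis i) (basis j) p * flip (tens u v) q *
     tens (tangent_mul F t (basis p.1) (basis q.1))
          (tangent_mul F t (basis p.2) (basis q.2)) (k, l) =
  tens (tangent_mul F t (basis i) v) (tangent_mul F t (basis j) u) (k, l).
  rewrite (bigD1 (i, j))//= [X in _ + X]big1 ?addr0; last first.
    move=> [a b] abN; rewrite big1// => q _; rewrite !ffunE !mxE /=.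
    have [ai|] := eqVneq a i; have [bj|] := eqVneq b j;
      rewrite ?(mulr0, mul0r)//.
    by move: abN; rewrite ai bj eqxx.
  rewrite [RHS]ffunE !tangent_mul_basisl /= mulr_suml.
  under [RHS]eq_bigr do rewrite mulr_sumr.
  rewrite pair_bigA /=; apply: eq_bigr => -[a b] _ /=.
  rewrite 4!ffunE !mxE !eqxx !mul1r /= !tangent_mul_basis.
  by rewrite [u 0 b * v 0 a]mulrC mulrACA.
have addE (f g : tensor2) x : (f + g) x = f x + g x by rewrite ffunE.
apply/ffunP => -[k l]; rewrite !addE -!key [LHS]ffunE.
rewrite -!big_split /=; apply: eq_bigr => p _.
rewrite -!big_split /=; apply: eq_bigr => q _.
by rewrite [casimir p]ffunE !mulrDl.
Qed.

End DubrovinFrobenius.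

(* Main.v *)
Require Import Defs.
From HB Require Import structures.
From mathcomp Require Import all_boot all_order all_algebra.
From mathcomp Require Import complex ring.
From mathcomp Require Import all_classical all_reals all_analysis.

Import Order.TTheory GRing.Theory Num.Theory.
Import numFieldNormedType.Exports.

Local Open Scope ring_scope.
Local Open Scope classical_set_scope.

(* Write L_i for the matrix of multiplication by e_i. As the third derivatives
   of F are symmetric, the product is associative iff the L_i commute, which
   for this potential is the single equation d = a^2 - b c. If they commute, R
   is multiplication followed by comultiplication, and each coefficient of
   either side of the Yang-Baxter equation is the trace of a product of the same
   six matrices L_i, one per leg. Conversely, one coefficient of the difference
   of the two sides is d - (a^2 - b c). Inserting phi = - lambda k_2 / 4 turns
   this equation into (t^2 lambda)^4 times the condition on the k_j, and t^2 can
   be moved away from 0 since U is open. *)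

(** Case analysis that keeps the names [ix1], [ix2], [ix3] in the goals. *)
Lemma ord3_ind (P : 'I_3 -> Prop) : P ix1 -> P ix2 -> P ix3 -> forall i, P i.
Proof.
move=> P1 P2 P3 [[|[|[|//]]] i3].
- by rewrite (_ : Ordinal i3 = ix1)//; apply: val_inj.
- by rewrite (_ : Ordinal i3 = ix2)//; apply: val_inj.
- by rewrite (_ : Ordinal i3 = ix3)//; apply: val_inj.
Qed.

(** * Differentiation rules for functions written pointwise *)

Section PointwiseDerivatives.
Variables (K : numFieldType) (V : normedModType K) (t v : V).

Lemma is_derive_fcst (c : K) : is_derive t v (fun=> c) 0.
Proof. exact: is_derive_cst. Qed.

Lemma is_derive_fadd {f g : V -> K} {df dg : K} :
  is_derive t v f df -> is_derive t v g dg ->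
  is_derive t v (fun x => f x + g x) (df + dg).
Proof. by move=> *; exact: is_deriveD. Qed.

Lemma is_derive_fopp {f : V -> K} {df : K} :
  is_derive t v f df -> is_derive t v (fun x => - f x) (- df).
Proof. by move=> *; exact: is_deriveN. Qed.

Lemma is_derive_fmul {f g : V -> K} {df dg : K} :
  is_derive t v f df -> is_derive t v g dg ->
  is_derive t v (fun x => f x * g x) (f t * dg + g t * df).
Proof. by move=> *; exact: is_deriveM. Qed.

Lemma is_derive_fexp {f : V -> K} {df : K} n :
  is_derive t v f df ->
  is_derive t v (fun x => f x ^+ n) (n%:R * f t ^+ n.-1 * df).
Proof.
move=> fdf; rewrite (_ : (fun _ => _) = f ^+ n); first exact: is_deriveX.
by apply/funext => x; rewrite fctE.
Qed.

End PointwiseDerivatives.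

Section CoordinateDerivatives.
Variables (K : numFieldType) (n : nat) (t v : 'rV[K]_n.+1) (i : 'I_n.+1).

Lemma diff_coord : 'd (fun u : 'rV[K]_n.+1 => u 0 i : K) t v = v 0 i.
Proof.
have coord_lin : linear (fun u : 'rV[K]_n.+1 => u 0 i : K).
  by move=> c x y; rewrite !mxE.
pose f : {linear 'rV[K]_n.+1 -> K} :=
  HB.pack (fun u : 'rV[K]_n.+1 => u 0 i : K)
    (GRing.isLinear.Build _ _ _ _ _ coord_lin).
by rewrite (_ : (fun _ => _) = f)// diff_lin//; exact: coord_continuous.
Qed.

Lemma is_derive_coord_comp {g : K -> K} {dg : K} :
  is_derive (t 0 i) 1 g dg ->
  is_derive t v (fun u : 'rV[K]_n.+1 => g (u 0 i)) (v 0 i * dg).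
Proof.
move=> [/derivable1_diffP gd <-].
have cd : differentiable (fun u : 'rV[K]_n.+1 => u 0 i : K) t.
  exact: differentiable_coord.
have gcd := differentiable_comp cd gd.
apply: DeriveDef; first exact: diff_derivable.
rewrite (deriveE _ gcd) diff_comp//= diff_coord deriveE//.
by rewrite -[v 0 i in LHS]mulr1 linearZ.
Qed.

Lemma is_derive_coord :
  is_derive t v (fun u : 'rV[K]_n.+1 => u 0 i : K) (v 0 i).
Proof. by rewrite -[v 0 i]mulr1; apply: is_derive_coord_comp. Qed.

End CoordinateDerivatives.

(** Each rule instantiates a derivative that is still unknown. Once [is_derive_coord_comp] has
    reduced to one variable, [eassumption] supplies the derivatives of [phi] and its successors. *)
Ltac derive_pointwise :=
  repeat first [ eassumption
               | apply: is_derive_fcst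
               | apply: is_derive_coord
               | apply: is_derive_fadd
               | apply: is_derive_fopp
               | apply: is_derive_fexp
               | apply: is_derive_fmul
               | apply: is_derive_coord_comp ].

(* Third derivatives of the potential, with [p] listing f_xxx, f_xxy, f_xyy,
   f_yyy. Indices are zero-based, and a symmetric function of three indices in
   {1, 2} depends only on their sum. *)
Definition cubic_form {K : numFieldType} (p : seq K) (i j k : 'I_3) : K :=
  if [|| val i == 0, val j == 0 | val k == 0]%N then (i + j + k == 2)%N%:R
  else p`_(i + j + k - 3).

(** * Derivatives of the potential up to order three *)

Section PotentialDerivatives.
Variables (K : numFieldType) (J : set K) (phi phi1 phi2 phi3 : K -> K).
Hypothesis J_open : open J.
Hypothesis phi_d : forall x, J x -> is_derive x 1 phi (phi1 x).
Hypothesis phi1_d : forall x, J x -> is_derive x 1 phi1 (phi2 x).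
Hypothesis phi2_d : forall x, J x -> is_derive x 1 phi2 (phi3 x).

Definition potential_grad (k : 'I_3) (t : 'rV[K]_3) : K :=
  [:: t 0 ix1 * t 0 ix3 + t 0 ix2 ^+ 2 / 2;
      t 0 ix1 * t 0 ix2 - t 0 ix2 ^+ 3 / 24 * phi (t 0 ix3);
      t 0 ix1 ^+ 2 / 2 - t 0 ix2 ^+ 4 / 96 * phi1 (t 0 ix3)]`_k.

Definition potential_hess (j k : 'I_3) (t : 'rV[K]_3) : K :=
  (nth [::]
   [:: [:: t 0 ix3; t 0 ix2; t 0 ix1];
      [:: t 0 ix2; t 0 ix1 - t 0 ix2 ^+ 2 / 8 * phi (t 0 ix3);
          - (t 0 ix2 ^+ 3 / 24) * phi1 (t 0 ix3)];
      [:: t 0 ix1; - (t 0 ix2 ^+ 3 / 24) * phi1 (t 0 ix3);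
          - (t 0 ix2 ^+ 4 / 96) * phi2 (t 0 ix3)]] j)`_k.

Lemma open_coord_preimage : open [set t : 'rV[K]_3 | J (t 0 ix3)].
Proof.
apply: (@open_comp _ _ (fun t : 'rV[K]_3 => t 0 ix3)) => // t _.
exact: coord_continuous.
Qed.

(** A closed form for a derivative is known only where t^3 lies in [J]. As [J] is open, it holds
    near [t] and can be differentiated again. *)
Lemma eq_pderiv i (G H : 'rV[K]_3 -> K) (t : 'rV[K]_3) :
  (forall u : 'rV[K]_3, J (u 0 ix3) -> G u = H u) -> J (t 0 ix3) ->
  pderiv i G t = pderiv i H t.
Proof.
move=> GH Jt; apply: near_eq_derive.
exact: filterS GH (open_nbhs_nbhs (conj open_coord_preimage Jt)).
Qed.

Lemma pderiv_potential k (t : 'rV[K]_3) : J (t 0 ix3) ->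
  pderiv k (potential phi) t = potential_grad k t.
Proof.
move=> Jt; have phi_dt := phi_d _ Jt.
rewrite /pderiv; apply: derive_val; apply: is_derive_eq.
  by rewrite /potential; derive_pointwise.
by elim/ord3_ind: k; rewrite !mxE /potential_grad /=; field.
Qed.

Lemma pderiv2_potential j k (t : 'rV[K]_3) : J (t 0 ix3) ->
  pderiv j (pderiv k (potential phi)) t = potential_hess j k t.
Proof.
move=> Jt; rewrite (eq_pderiv _ _ _ _ (pderiv_potential k)) //.
have phi_dt := phi_d _ Jt; have phi1_dt := phi1_d _ Jt.
rewrite /pderiv; apply: derive_val; rewrite /potential_grad.
elim/ord3_ind: k => /=; (apply: is_derive_eq; [by derive_pointwise|]).
all: by elim/ord3_ind: j; rewrite !mxE /potential_hess /=; field.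
Qed.

Lemma pderiv3_potential i j k (t : 'rV[K]_3) : J (t 0 ix3) ->
  pderiv i (pderiv j (pderiv k (potential phi))) t =
  let x := t 0 ix2 in let y := t 0 ix3 in
  cubic_form [:: - (x / 4) * phi y; - (x ^+ 2 / 8) * phi1 y;
                 - (x ^+ 3 / 24) * phi2 y; - (x ^+ 4 / 96) * phi3 y] i j k.
Proof.
move=> Jt; rewrite (eq_pderiv _ _ _ _ (pderiv2_potential j k)) //.
have phi_dt := phi_d _ Jt; have phi1_dt := phi1_d _ Jt.
have phi2_dt := phi2_d _ Jt.
rewrite /pderiv; apply: derive_val; rewrite /potential_hess.
elim/ord3_ind: k; elim/ord3_ind: j => /=;
  (apply: is_derive_eq; [by derive_pointwise|]).
all: by elim/ord3_ind: i; rewrite !mxE /cubic_form /=; field.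
Qed.

End PotentialDerivatives.

(** * The Yang-Baxter equation in coordinates *)

Section YangBaxterKernel.
Variables (K : numFieldType) (S : tensor2 K -> tensor2 K).
Variable c : 'I_3 -> 'I_3 -> 'I_3 -> 'I_3 -> K.
Hypothesis SE : forall w k l, S w (k, l) = \sum_i \sum_j w (i, j) * c i j k l.

Let basis3 (i j k : 'I_3) : tensor3 K := [ffun p => (p == (i, j, k))%:R].

Let sum_pair_delta (i j : 'I_3) (g : 'I_3 -> 'I_3 -> K) :
  \sum_p \sum_q ((p, q) == (i, j))%:R * g p q = g i j.
Proof.
rewrite (bigD1 i)//= [X in _ + X]big1 ?addr0 => [|p pi]; last first.
  by rewrite big1// => q _; rewrite xpair_eqE (negbTE pi) mul0r.
rewrite (bigD1 j)//= eqxx mul1r [X in _ + X]big1 ?addr0// => q qj.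
by rewrite xpair_eqE (negbTE qj) andbF mul0r.
Qed.

Let act12E (w : tensor3 K) l m n :
  act12 S w (l, m, n) = \sum_i \sum_j w (i, j, n) * c i j l m.
Proof. by rewrite ffunE SE; do 2![apply: eq_bigr => ? _]; rewrite ffunE. Qed.

Let act13E (w : tensor3 K) l m n :
  act13 S w (l, m, n) = \sum_i \sum_k w (i, m, k) * c i k l n.
Proof. by rewrite ffunE SE; do 2![apply: eq_bigr => ? _]; rewrite ffunE. Qed.

Let act23E (w : tensor3 K) l m n :
  act23 S w (l, m, n) = \sum_j \sum_k w (l, j, k) * c j k m n.
Proof. by rewrite ffunE SE; do 2![apply: eq_bigr => ? _]; rewrite ffunE. Qed.

Let sum_rot3 (f : 'I_3 -> 'I_3 -> 'I_3 -> K) :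
  \sum_p \sum_q \sum_i f p q i = \sum_i \sum_p \sum_q f p q i.
Proof.
by under eq_bigr do rewrite exchange_big; rewrite exchange_big.
Qed.

Let sum_rot4 (f : 'I_3 -> 'I_3 -> 'I_3 -> 'I_3 -> K) :
  \sum_p \sum_q \sum_r \sum_i f p q r i = \sum_i \sum_p \sum_q \sum_r f p q r i.
Proof. by under eq_bigr do rewrite sum_rot3; rewrite exchange_big. Qed.

(** Each factor is one application of [S]: legs 2, 3 turn [j], [k] into [q], [r]; then legs 1, 3
    turn [i], [r] into [s], [n]; then legs 1, 2 turn [s], [q] into [l], [m]. *)
Lemma act_rtl_kernel (w : tensor3 K) l m n :
  (act12 S \o act13 S \o act23 S) w (l, m, n) =
  \sum_i \sum_j \sum_k w (i, j, k) *
    \sum_q \sum_r \sum_s c j k q r * c i r s n * c s q l m.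
Proof.
(* The sums stand in the order in which unfolding from the outermost operator produces them. *)
transitivity (\sum_s \sum_q \sum_i \sum_r \sum_j \sum_k
    w (i, j, k) * (c j k q r * c i r s n * c s q l m)).
  rewrite act12E; apply: eq_bigr => s _; apply: eq_bigr => q _.
  rewrite act13E mulr_suml; apply: eq_bigr => i _.
  rewrite mulr_suml; apply: eq_bigr => r _.
  rewrite act23E -mulrA mulr_suml; apply: eq_bigr => j _.
  by rewrite mulr_suml; apply: eq_bigr => k _; rewrite !mulrA.
rewrite sum_rot3; apply: eq_bigr => i _.
rewrite sum_rot4; apply: eq_bigr => j _.
rewrite sum_rot4; apply: eq_bigr => k _.
rewrite -[LHS]sum_rot3 mulr_sumr; apply: eq_bigr => q _.
by rewrite mulr_sumr; apply: eq_bigr => r _; rewrite mulr_sumr.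
Qed.

Lemma act_ltr_kernel (w : tensor3 K) l m n :
  (act23 S \o act13 S \o act12 S) w (l, m, n) =
  \sum_i \sum_j \sum_k w (i, j, k) *
    \sum_q \sum_r \sum_s c i j q r * c q k l s * c r s m n.
Proof.
transitivity (\sum_r \sum_s \sum_q \sum_k \sum_i \sum_j
    w (i, j, k) * (c i j q r * c q k l s * c r s m n)).
  rewrite act23E; apply: eq_bigr => r _; apply: eq_bigr => s _.
  rewrite act13E mulr_suml; apply: eq_bigr => q _.
  rewrite mulr_suml; apply: eq_bigr => k _.
  rewrite act12E -mulrA mulr_suml; apply: eq_bigr => i _.
  by rewrite mulr_suml; apply: eq_bigr => j _; rewrite !mulrA.
rewrite [RHS]sum_rot3 sum_rot4; apply: eq_bigr => k _.
rewrite sum_rot4; apply: eq_bigr => i _.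
rewrite sum_rot4; apply: eq_bigr => j _.
rewrite sum_rot3 mulr_sumr; apply: eq_bigr => q _.
by rewrite mulr_sumr; apply: eq_bigr => r _; rewrite mulr_sumr.
Qed.

(** Both sides are linear in the tensor, so testing them on the [basis3 i j k] suffices. *)
Lemma quantum_yang_baxter_kernel :
  quantum_yang_baxter S <->
  forall i j k l m n,
    \sum_q \sum_r \sum_s c j k q r * c i r s n * c s q l m =
    \sum_q \sum_r \sum_s c i j q r * c q k l s * c r s m n.
Proof.
have b3E i j k (g : 'I_3 -> 'I_3 -> 'I_3 -> K) :
    \sum_p \sum_q \sum_r basis3 i j k (p, q, r) * g p q r = g i j k.
  rewrite -[RHS](sum_pair_delta i j (fun p q => g p q k)).
  apply: eq_bigr => p _; apply: eq_bigr => q _.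
  rewrite (bigD1 k)//= [X in _ + X]big1 ?addr0 => [|r rk].
    by rewrite ffunE [in LHS]xpair_eqE eqxx andbT.
  by rewrite ffunE xpair_eqE (negbTE rk) andbF mul0r.
split=> [yb i j k l m n|eq_c w].
  have := congr1 (fun w : tensor3 K => w (l, m, n)) (yb (basis3 i j k)).
  by rewrite act_rtl_kernel act_ltr_kernel !b3E.
apply/ffunP => -[[l m] n]; rewrite act_rtl_kernel act_ltr_kernel.
by do 3![apply: eq_bigr => ? _]; rewrite eq_c.
Qed.

End YangBaxterKernel.

(** * Symmetric forms with commuting multiplications *)

Section SymmetricForm.
Variables (K : numFieldType) (T : 'I_3 -> 'I_3 -> 'I_3 -> K).
Hypothesis T_sym12 : forall i j k, T i j k = T j i k.
Hypothesis T_sym23 : forall i j k, T i j k = T i k j.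

(** Row [a] holds the coordinates of e_i e_a; [rev_ord] raises the last index by the metric. *)
Definition mul_matrix (i : 'I_3) : 'M[K]_3 := \matrix_(a, b) T i a (rev_ord b).

(** The coefficient of e_k (x) e_l in R(e_i (x) e_j): the Casimir element pairs [p] with
    [rev_ord p], and the flip lets e_p multiply e_j. *)
Definition R_kernel (i j k l : 'I_3) : K :=
  \sum_p T p j (rev_ord k) * T (rev_ord p) i (rev_ord l).

Local Notation L := mul_matrix.

Lemma mul_matrixE i j a b :
  (L i * L j) a b = \sum_p T i a p * T j (rev_ord p) (rev_ord b).
Proof.
rewrite mxE (reindex_inj rev_ord_inj)/=.
by apply: eq_bigr => p _; rewrite !mxE rev_ordK.
Qed.

(** By symmetry of [T], the index contracted through the Casimir element is the inner index of a
    matrix product. *)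
Lemma R_kernelE i j k l : R_kernel i j k l = (L j * L i) (rev_ord k) l.
Proof.
rewrite mul_matrixE; apply: eq_bigr => p _.
by rewrite T_sym12 T_sym23 [T _ i _]T_sym12.
Qed.

(** Symmetry of [T] makes each [L i] self-adjoint for the metric. The adjoint is reflection in the
    antidiagonal, and it reverses products. *)
Lemma mul_matrix_adj i j a b :
  (L i * L j) a b = (L j * L i) (rev_ord b) (rev_ord a).
Proof.
rewrite !mul_matrixE [RHS](reindex_inj rev_ord_inj)/=.
apply: eq_bigr => p _; rewrite !rev_ordK mulrC.
by rewrite T_sym23 [T i a p]T_sym23.
Qed.

(* Under [LC] the four indices of [(L i * L j) a (rev_ord b)] can be permuted
   freely. *)
Hypothesis LC : forall i j, L i * L j = L j * L i.

(** Once [LC] puts the factor of [j] first, [j] and [a] are two arguments of the same [T]. *)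
Lemma mul_matrix_swap_row i j a b : (L i * L j) a b = (L i * L a) j b.
Proof.
rewrite (LC i j) (LC i a) !mul_matrixE; apply: eq_bigr => p _.
by rewrite T_sym12.
Qed.

Lemma mul_matrix_swap_col i j a b :
  (L i * L j) a b = (L i * L (rev_ord b)) a (rev_ord j).
Proof.
by rewrite mul_matrix_adj LC mul_matrix_swap_row mul_matrix_adj LC rev_ordK.
Qed.

Lemma mxtrace_mul3 (A B C : 'M[K]_3) :
  \tr (A * B * C) = \sum_q \sum_r \sum_s A q r * B r s * C s q.
Proof.
rewrite /mxtrace; apply: eq_bigr => q _; rewrite mxE exchange_big/=.
by apply: eq_bigr => s _; rewrite mxE mulr_suml.
Qed.

(** Each summed index occurs in two kernels. The swaps make it the column of one matrix product and
    the row of the next, so that the outer indices label the matrices and the triple sum is a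
    trace. *)
Lemma R_kernel_yang_baxter i j k l m n :
  \sum_q \sum_r \sum_s R_kernel j k q r * R_kernel i r s n * R_kernel s q l m =
  \sum_q \sum_r \sum_s R_kernel i j q r * R_kernel q k l s * R_kernel r s m n.
Proof.
transitivity (\tr ((L k * L j) * (L i * L (rev_ord n))
                   * (L (rev_ord l) * L (rev_ord m)))).
  (* [R_kernelE] reverses the index [q] of the first kernel, so the trace is reindexed to match. *)
  rewrite mxtrace_mul3 [RHS](reindex_inj rev_ord_inj)/=.
  apply: eq_bigr => q _; apply: eq_bigr => r _; apply: eq_bigr => s _.
  rewrite !R_kernelE; congr (_ * _ * _).
    by rewrite LC mul_matrix_swap_row mul_matrix_swap_col rev_ordK.
  by rewrite mul_matrix_swap_row LC mul_matrix_swap_col.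
transitivity (\tr ((L j * L i) * (L (rev_ord m) * L (rev_ord n))
                   * (L k * L (rev_ord l)))).
  (* Cyclicity carries [L k] to the end; commutation does the rest. *)
  rewrite -!mulrA -!mulmxE mxtrace_mulC !mulmxE -!mulrA.
  congr (\tr (_ * (_ * _))).
  have LCA x y (A : 'M[K]_3) : L x * (L y * A) = L y * (L x * A).
    by rewrite !mulrA (LC x).
  by rewrite (LCA _ (rev_ord m)) (LCA _ (rev_ord m)) (LC _ k).
rewrite mxtrace_mul3 [LHS](reindex_inj rev_ord_inj)/=.
apply: eq_bigr => q _; apply: eq_bigr => r _.
rewrite [LHS](reindex_inj rev_ord_inj)/=; apply: eq_bigr => s _.
rewrite !R_kernelE [RHS]mulrAC; congr (_ * _ * _).
  by rewrite [RHS]mul_matrix_swap_row [in RHS]LC [RHS]mul_matrix_swap_col.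
by rewrite [RHS]mul_matrix_swap_row [LHS]mul_matrix_adj [in LHS]LC !rev_ordK.
Qed.

End SymmetricForm.

Arguments mul_matrix {K}.
Arguments R_kernel {K}.

Lemma sum_ord3 (V : nmodType) (f : 'I_3 -> V) :
  \sum_i f i = f ix1 + f ix2 + f ix3.
Proof.
rewrite !big_ord_recl big_ord0 addr0 addrA.
by congr (f _ + f _ + f _); apply: val_inj.
Qed.

(** * The cubic form of the potential *)

Section CubicForm.
Variables (K : numFieldType) (a b c d : K).
Local Notation T := (cubic_form [:: b; a; c; d]).

Lemma cubic_form_sym12 (p : seq K) i j k :
  cubic_form p i j k = cubic_form p j i k.
Proof. by rewrite /cubic_form orbCA (addnC i j). Qed.

Lemma cubic_form_sym23 (p : seq K) i j k :
  cubic_form p i j k = cubic_form p i k j.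
Proof.
by rewrite /cubic_form (orbC (val j == 0)%N) -!addnA (addnC j k).
Qed.

(** As e_1 is the unit, only e_2 and e_3 give a condition: the entries of their commutator are 0 or,
    up to sign, d - (a^2 - b c). *)
Lemma mul_matrixC : d = a ^+ 2 - b * c ->
  forall i j, mul_matrix T i * mul_matrix T j = mul_matrix T j * mul_matrix T i.
Proof.
move=> -> i j; apply/matrixP => x y; rewrite !mul_matrixE !sum_ord3.
elim/ord3_ind: i; elim/ord3_ind: j; elim/ord3_ind: x; elim/ord3_ind: y.
all: by rewrite /cubic_form /=; ring.
Qed.

(* The coefficient of e_1 (x) e_2 (x) e_3 in the image of e_1 (x) e_1 (x) e_2. *)
Lemma R_kernel_witness :
  \sum_q \sum_r \sum_s R_kernel T ix1 ix2 q r * R_kernel T ix1 r s ix3 *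
                       R_kernel T s q ix1 ix2 -
  \sum_q \sum_r \sum_s R_kernel T ix1 ix1 q r * R_kernel T q ix2 ix1 s *
                       R_kernel T r s ix2 ix3 = d - (a ^+ 2 - b * c).
Proof.
(* As e_1 is the unit, a kernel with input e_1 collapses to a single value of [T]. *)
have E1 j k l : R_kernel T ix1 j k l = T (rev_ord l) j (rev_ord k).
  rewrite /R_kernel sum_ord3 /cubic_form.
  by elim/ord3_ind: j; elim/ord3_ind: k; elim/ord3_ind: l; rewrite /=; ring.
have E2 i k l : R_kernel T i ix1 k l = T i (rev_ord k) (rev_ord l).
  rewrite /R_kernel sum_ord3 /cubic_form.
  by elim/ord3_ind: i; elim/ord3_ind: k; elim/ord3_ind: l; rewrite /=; ring.
by rewrite !sum_ord3 !E1 E2 /R_kernel !sum_ord3 /cubic_form /=; ring.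
Qed.

End CubicForm.

(** * The operator R and the final equivalence *)

Lemma casimirE (K : numFieldType) i j : casimir K (i, j) = (j == rev_ord i)%:R.
Proof.
rewrite !ffunE !mxE /=.
by elim/ord3_ind: i; elim/ord3_ind: j; rewrite /=; ring.
Qed.

Lemma R_operatorE (K : numFieldType) (F : 'rV[K]_3 -> K) t w k l :
  R_operator F t w (k, l) = \sum_i \sum_j w (i, j) *
    \sum_p struct_const F t p j k * struct_const F t (rev_ord p) i l.
Proof.
have sum_pair (f : 'I_3 * 'I_3 -> K) : \sum_p f p = \sum_i \sum_j f (i, j).
  by rewrite pair_bigA; apply: eq_bigr => -[].
rewrite ffunE sum_pair.
transitivity (\sum_p \sum_j \sum_i w (i, j) *
    (struct_const F t p j k * struct_const F t (rev_ord p) i l)).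
  apply: eq_bigr => p _; rewrite (bigD1 (rev_ord p))//= [X in _ + X]big1 ?addr0.
    rewrite sum_pair; apply: eq_bigr => j _; apply: eq_bigr => i _.
    by rewrite casimirE eqxx mul1r !ffunE /= !tangent_mul_basis.
  by move=> p' pp'; rewrite big1// => q _; rewrite casimirE (negbTE pp') !mul0r.
under eq_bigr do rewrite exchange_big.
rewrite exchange_big; apply: eq_bigr => i _.
by rewrite exchange_big; apply: eq_bigr => j _; rewrite mulr_sumr.
Qed.

Lemma quantum_yang_baxter_cubic (K : numFieldType) (F : 'rV[K]_3 -> K) t
    a b c d :
  (forall i j k, pderiv i (pderiv j (pderiv k F)) t
     = cubic_form [:: b; a; c; d] i j k) ->
  quantum_yang_baxter (R_operator F t) <-> d = a ^+ 2 - b * c.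
Proof.
move=> FT; set T := cubic_form _ in FT.
have RE w k l : R_operator F t w (k, l) =
    \sum_i \sum_j w (i, j) * R_kernel T i j k l.
  rewrite R_operatorE; do 2![apply: eq_bigr => ? _]; congr (_ * _).
  by apply: eq_bigr => p _; rewrite /struct_const !FT.
rewrite (quantum_yang_baxter_kernel _ _ _ RE); split => [yb|dE i j k l m n].
  apply/eqP; rewrite -subr_eq0 -(R_kernel_witness _ a b c d).
  by rewrite subr_eq0; apply/eqP/yb.
apply: R_kernel_yang_baxter => *; first exact: cubic_form_sym12.
  exact: cubic_form_sym23.
exact: (mul_matrixC _ _ _ _ _ dE).
Qed.

(** The equation at [t] carries the factor (t^2)^4. A small move along e_2 makes it invertible and
    keeps t^3, hence the values of the k_j. *)
Lemma open_avoid_zero_coord (K : numFieldType) (n : nat) (U : set 'rV[K]_n.+1)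
    (t : 'rV[K]_n.+1) (i : 'I_n.+1) : open U -> U t ->
  exists u, [/\ U u, u 0 i != 0 & forall j, j != i -> u 0 j = t 0 j].
Proof.
move=> Uo Ut; have [ti0|ti0] := eqVneq (t 0 i) 0; last by exists t.
pose g (h : K) := h *: delta_mx 0 i + t : 'rV[K]_n.+1.
have gc : continuous g.
  move=> h; apply: cvgD; first exact: nbhs_filter.
    exact: scalel_continuous.
  exact: cst_continuous.
have Ug : \forall h \near 0^', U (g h).
  apply: cvg_within; apply: gc; rewrite /g scale0r add0r.
  exact: open_nbhs_nbhs.
have [h [Uh h0]] := filter_ex (filterI Ug (nbhs_dnbhs_neq (0 : K))).
exists (g h); split => // [|j ji]; rewrite !mxE eqxx ?eqxx /=.
  by rewrite ti0 mulr1 addr0.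
by rewrite (negbTE ji) mulr0 add0r.
Qed.

(** Over any [numFieldType], to treat the real and complex cases at once. *)
Lemma quantum_yang_baxter_iff_two_valued (K : numFieldType) (lambda : K)
    (J : set K) (k2 k4 k6 k8 : K -> K) (U : set 'rV[K]_3) :
  lambda != 0 -> open J -> open U -> [set t 0 ix3 | t in U] = J ->
  (forall x, J x -> is_derive x 1 k2 (lambda / 2 * k4 x)) ->
  (forall x, J x -> is_derive x 1 k4 (3 * lambda / 4 * k6 x)) ->
  (forall x, J x -> is_derive x 1 k6 (lambda * k8 x)) ->
  (forall x, J x -> 4 * k8 x = k4 x ^+ 2 - k6 x * k2 x) <->
  (forall t, U t -> quantum_yang_baxter
     (R_operator (potential (fun x => - lambda * k2 x / 4)) t)).
Proof.
move=> lambda_neq0 Jo Uo U_proj k2_d k4_d k6_d.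
set phi := fun x => - lambda * k2 x / 4; set F := potential phi.
(* The derivatives of [phi]: the constant - lambda / 4 is multiplied in turn by lambda / 2, 3 lambda
   / 4 and lambda. *)
pose phi1 x := - (lambda ^+ 2 / 8) * k4 x.
pose phi2 x := - (3 * lambda ^+ 3 / 32) * k6 x.
pose phi3 x := - (3 * lambda ^+ 4 / 32) * k8 x.
have phi_d x : J x -> is_derive x 1 phi (phi1 x).
  move=> Jx; rewrite (_ : phi = fun y => - (lambda / 4) * k2 y).
    apply: is_derive_eq; first
      by apply: is_derive_fmul _ _ _ _ (is_derive_fcst _ _ _ _ _) (k2_d x Jx).
    by rewrite /phi1; field.
  by apply/funext => y; rewrite /phi; field.
have phi1_d x : J x -> is_derive x 1 phi1 (phi2 x).
  move=> Jx; apply: is_derive_eq; first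
      by apply: is_derive_fmul _ _ _ _ (is_derive_fcst _ _ _ _ _) (k4_d x Jx).
  by rewrite /phi2; field.
have phi2_d x : J x -> is_derive x 1 phi2 (phi3 x).
  move=> Jx; apply: is_derive_eq; first
      by apply: is_derive_fmul _ _ _ _ (is_derive_fcst _ _ _ _ _) (k6_d x Jx).
  by rewrite /phi3; field.
have UJ t : U t -> J (t 0 ix3) by rewrite -U_proj => Ut; exists t.
have ybE t : U t -> quantum_yang_baxter (R_operator F t) <->
    (t 0 ix2 * lambda) ^+ 4 * (4 * k8 (t 0 ix3)) =
    (t 0 ix2 * lambda) ^+ 4 *
      (k4 (t 0 ix3) ^+ 2 - k6 (t 0 ix3) * k2 (t 0 ix3)).
  move=> Ut.
  have := pderiv3_potential _ _ _ _ _ _ Jo phi_d phi1_d phi2_d _ _ _ _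
    (UJ t Ut).
  move=> /quantum_yang_baxter_cubic ->.
  set x := t 0 ix2; set y := t 0 ix3.
  (* With z = x lambda, the form has b = z k2 / 16, a = z^2 k4 / 64, c = z^3 k6 / 256 and d = z^4 k8
     / 1024, so both sides share the factor z^4 / 64^2. *)
  rewrite (_ : - (x ^+ 4 / 96) * phi3 y =
    (x * lambda) ^+ 4 * (4 * k8 y) / 64 ^+ 2);
    last by rewrite /phi3; field.
  rewrite (_ : _ - _ =
    (x * lambda) ^+ 4 * (k4 y ^+ 2 - k6 y * k2 y) / 64 ^+ 2); last first.
    by rewrite /phi /phi1 /phi2; field.
  have n0 : 64 ^+ 2 != 0 :> K by rewrite expf_neq0// pnatr_eq0.
  by split=> [/(divIf n0)|->].
split=> [assoc t Ut|yb x].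
  by apply/ybE => //; rewrite assoc//; exact: UJ.
rewrite -U_proj => -[t Ut <-].
have [] := open_avoid_zero_coord _ _ U t ix2 Uo Ut.
move=> u [Uu u2 ut]; have /(ybE u Uu) := yb u Uu.
by rewrite (ut ix3)// => /mulfI; apply; rewrite expf_neq0// mulf_neq0.
Qed.

Lemma smooth_on_derivable (R : realType) (s : scalars)
    (J : set (scalar_field R s)) (f : scalar_field R s -> scalar_field R s) :
  smooth_on J f -> forall x, J x -> derivable f x 1.
Proof. by case: s J f => J f // /(_ 0%N). Qed.

Theorem corollary8p1 (R : realType) (s : scalars)
  (lambda : scalar_field R s) (lambda_neq0 : lambda != 0)
  (J : set (scalar_field R s)) (J_domain : domain J)
  (k2 k4 k6 k8 : scalar_field R s -> scalar_field R s)
  (k2_smooth : smooth_on J k2) (k4_smooth : smooth_on J k4)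
  (k6_smooth : smooth_on J k6) (k8_smooth : smooth_on J k8)
  (k2' : forall x, J x -> k2^`() x = lambda / 2 * k4 x)
  (k4' : forall x, J x -> k4^`() x = 3 * lambda / 4 * k6 x)
  (k6' : forall x, J x -> k6^`() x = lambda * k8 x)
  (U : set 'rV[scalar_field R s]_3) (U_domain : domain U)
  (U_proj : [set t 0 ix3 | t in U] = J) :
  let phi := fun x => - lambda * k2 x / 4 in
  let F := potential phi in
  (forall x, J x -> 4 * k8 x = k4 x ^+ 2 - k6 x * k2 x) <->
  (forall t, U t -> quantum_yang_baxter (R_operator F t)).
Proof.
have is_d (k dk : scalar_field R s -> scalar_field R s) : smooth_on J k ->
    (forall x, J x -> k^`() x = dk x) ->
    forall x, J x -> is_derive x 1 k (dk x).
  move=> ks kE x Jx; apply: DeriveDef; first exact: smooth_on_derivable ks x Jx.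
  by rewrite -derive1E kE.
case: J_domain U_domain => [_ _ Jo] [_ _ Uo].
by apply: quantum_yang_baxter_iff_two_valued => //; exact: is_d.
Qed.
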